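(* Let $(X,\mathcal{A},\mu)$ be a measure space, where $\mu$ is an arbitrary positive measure on the $\sigma$-algebra $\mathcal{A}$. Then $L^1(X)$ has the weak Banach-Saks property, i.e., for every sequence $(u_n)_n\subset L^1(X)$ and every $u\in L^1(X)$ such that $u_n\rightharpoonup u$ weakly in $L^1(X)$, there is a subsequence $(u_{n_j})_j$ such that $$\Big\|\frac{1}{j}\sum_{k=1}^{j}u_{n_k}-u\Big\|_{L^1(X)}\xrightarrow{j\to\infty}0.$$
   Context: $L^1(X)$ denotes the usual Lebesgue space associated with the measure space $(X,\mathcal{A},\mu)$; no restriction (such as finiteness or $\sigma$-finiteness) is imposed on $\mu$. A sequence $(u_n)_n\subset L^1(X)$ converges weakly to $u$ in $L^1(X)$, written $u_n\rightharpoonup u$, if $(v,u_n-u)_{(L^1(X))',L^1(X)}\to 0$ as $n\to\infty$ for all $v\in (L^1(X))'$, where $(L^1(X))'$ is the (continuous) dual space of $L^1(X)$ and $(\cdot,\cdot)_{(L^1(X))',L^1(X)}$ is the dual pairing. A subsequence $(u_{n_j})_j$ is given by a strictly increasing sequence of indices $n_1<n_2<\cdots$. *)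

(* Defs.v *)
From HB Require Import structures.
From mathcomp Require Import all_boot all_order all_algebra.
From mathcomp Require Import all_classical all_reals all_analysis.
From mathcomp Require Import measurable_realfun ess_sup_inf.

Set Implicit Arguments.
Unset Strict Implicit.
Unset Printing Implicit Defensive.

Import Order.TTheory GRing.Theory Num.Theory.
Import numFieldNormedType.Exports.

Local Open Scope classical_set_scope.
Local Open Scope ring_scope.

(* [LspaceType mu p1] is MathComp-Analysis' space of measurable functions with
   finite p-norm, modulo mu-almost everywhere equality; the library gives it no
   algebraic or topological structure. Here it becomes a normed module over R,
   with the operations of [LfunType mu p1] computed on representatives and the
   norm 'N[mu]_p; [class_LspaceD], [class_LspaceN], [class_LspaceZ] and
   [norm_class_Lspace] show independence of the representatives. *)
Section Lspace_normed_module.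
Context d (T : measurableType d) (R : realType).
Variables (mu : {measure set T -> \bar R}) (p : \bar R) (p1 : (1 <= p)%E).
Implicit Types (f g h : LfunType mu p1) (F G H : LspaceType mu p1).

Lemma ae_eq_Lnorm (f g : {mfun T >-> R}) : f = g %[ae mu] ->
  ('N[mu]_p[EFin \o f] = 'N[mu]_p[EFin \o g])%E.
Proof.
move=> fg; rewrite unlock /Lnorm; case: p p1 => //= [r _|_].
  have mr (h : {mfun T >-> R}) :
      measurable_fun setT (fun x => `|(h x)%:E| `^ r)%E.
    apply: (@measurableT_comp _ _ _ _ _ _ (poweR ^~ r)) => //.
      exact: measurable_poweR.
    by apply: measurableT_comp => //; exact/measurable_EFinP.
  congr poweR; apply: ge0_ae_eq_integral => //; [exact: mr|exact: mr|].
  by apply: filterS fg => x /= /(_ Logic.I) ->.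
case: ifPn => // _; apply: eq_ess_sup.
by apply: filterS fg => x /= /(_ Logic.I) ->.
Qed.

(* The library builds [LspaceType] from functions valued in [measurableTypeR R],
   which is R with the same measurable sets but another display. *)
Lemma repr_Lspace_measurable F : measurable_fun setT (F : T -> R).
Proof.
exact: (@measurable_funPT _ _ T (measurableTypeR R)
  (repr (F : {mfun_ mu, T >-> measurableTypeR R}))).
Qed.

Lemma repr_Lspace_Lfun F : (F : T -> R) \in Lfun mu p.
Proof.
rewrite inE; apply/andP; split; rewrite inE/=; first exact: repr_Lspace_measurable.
exact: Lebesgue_finite.
Qed.

Definition repr_Lspace F : LfunType mu p1 := Lfun_Sub p1 (repr_Lspace_Lfun F).

Lemma repr_LspaceE F : repr_Lspace F = F :> (T -> R).
Proof. by []. Qed.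

Lemma ae_eq_Lspace F G : (F : T -> R) = G %[ae mu] -> F = G.
Proof.
case: F G => [F [[Ff]]] [G [[Gf]]] /= FG.
have FGE : F = G.
  rewrite -(reprK F) -(reprK G); apply/eqquotP; exact/asboolP.
by case: _ / FGE in Gf FG *; rewrite (bool_irrelevance Ff Gf).
Qed.

Lemma Lfun_measurable f : @measurable_fun _ _ T (measurableTypeR R) setT f.
Proof. exact: (@measurable_funPT _ _ T R f). Qed.

Definition class_mfun f : {mfun_ mu, T >-> measurableTypeR R} :=
  \pi_({mfun_ mu, T >-> measurableTypeR R})%qT
    (HB.pack (f : T -> measurableTypeR R)
      (isMeasurableFun.Build _ _ _ _ (f : T -> measurableTypeR R)
         (Lfun_measurable f))).

Lemma class_mfunE f : (class_mfun f : T -> R) = f %[ae mu].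
Proof. by have /eqquotP/asboolP := reprK (class_mfun f). Qed.

Lemma class_mfun_finite f : finite_norm mu p (class_mfun f : T -> R).
Proof.
have mF : @measurable_fun _ _ T R setT (class_mfun f : T -> R).
  exact: (@measurable_funPT _ _ T (measurableTypeR R) (repr (class_mfun f))).
pose F : {mfun T >-> R} :=
  HB.pack (class_mfun f : T -> R) (isMeasurableFun.Build _ _ _ _ _ mF).
rewrite /finite_norm (_ : Lnorm _ _ _ = 'N[mu]_p[EFin \o f])%E.
  exact: Lfunction_finite.
exact: (@ae_eq_Lnorm F f (class_mfunE f)).
Qed.

Definition class_Lspace f : LspaceType mu p1 :=
  HB.pack (class_mfun f)
    (isFinLebesgue.Build _ _ _ mu p p1 (class_mfun f) (class_mfun_finite f)).

Lemma class_LspaceE f : (class_Lspace f : T -> R) = f %[ae mu].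
Proof. exact: class_mfunE. Qed.

Lemma repr_LspaceK : cancel repr_Lspace class_Lspace.
Proof. by move=> F; apply: ae_eq_Lspace; exact: class_LspaceE. Qed.

Lemma class_Lspace_eqP f g : class_Lspace f = class_Lspace g <-> f = g %[ae mu].
Proof.
split=> [fg|fg]; last first.
  apply: ae_eq_Lspace; apply: ae_eq_trans (class_LspaceE f) _.
  by apply: ae_eq_trans fg _; apply: ae_eq_sym; exact: class_LspaceE.
apply: ae_eq_trans (class_LspaceE g); rewrite -fg.
by apply: ae_eq_sym; exact: class_LspaceE.
Qed.

HB.instance Definition _ := gen_eqMixin (LspaceType mu p1).
HB.instance Definition _ := gen_choiceMixin (LspaceType mu p1).

Let zero : LspaceType mu p1 := class_Lspace 0.
Let opp F := class_Lspace (- repr_Lspace F).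
Let add F G := class_Lspace (repr_Lspace F + repr_Lspace G).
Let scale (a : R) F := class_Lspace (a *: repr_Lspace F).

Let addE f g : add (class_Lspace f) (class_Lspace g) = class_Lspace (f + g).
Proof.
apply/class_Lspace_eqP.
apply: filterS2 (class_LspaceE f) (class_LspaceE g) => x fx gx _ /=.
by rewrite [LHS](_ : _ = f x + g x)// -fx// -gx.
Qed.

Let oppE f : opp (class_Lspace f) = class_Lspace (- f).
Proof.
apply/class_Lspace_eqP; apply: filterS (class_LspaceE f) => x fx _ /=.
by rewrite [LHS](_ : _ = - f x)// -fx.
Qed.

Let scaleE a f : scale a (class_Lspace f) = class_Lspace (a *: f).
Proof.
apply/class_Lspace_eqP; apply: filterS (class_LspaceE f) => x fx _ /=.
by rewrite [LHS](_ : _ = a *: f x)// -fx.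
Qed.

Let LspaceP F : exists f, F = class_Lspace f.
Proof. by exists (repr_Lspace F); rewrite repr_LspaceK. Qed.

Let addA : associative add.
Proof.
move=> F G H; have [f ->] := LspaceP F; have [g ->] := LspaceP G.
by have [h ->] := LspaceP H; rewrite !addE addrA.
Qed.

Let addC : commutative add.
Proof.
move=> F G; have [f ->] := LspaceP F; have [g ->] := LspaceP G.
by rewrite !addE addrC.
Qed.

Let add0 : left_id zero add.
Proof. by move=> F; have [f ->] := LspaceP F; rewrite addE add0r. Qed.

Let addN : left_inverse zero opp add.
Proof. by move=> F; have [f ->] := LspaceP F; rewrite oppE addE addNr. Qed.

HB.instance Definition _ :=
  GRing.isZmodule.Build (LspaceType mu p1) addA addC add0 addN.

Lemma class_Lspace0 : class_Lspace 0 = 0.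
Proof. by []. Qed.

Lemma class_LspaceD f g :
  class_Lspace (f + g) = class_Lspace f + class_Lspace g.
Proof. by rewrite -addE. Qed.

Lemma class_LspaceN f : class_Lspace (- f) = - class_Lspace f.
Proof. by rewrite -oppE. Qed.

Let scaleA a b F : scale a (scale b F) = scale (a * b) F.
Proof. by have [f ->] := LspaceP F; rewrite !scaleE scalerA. Qed.

Let scale1 : left_id 1 scale.
Proof. by move=> F; have [f ->] := LspaceP F; rewrite scaleE scale1r. Qed.

Let scaleDr : right_distributive scale +%R.
Proof.
move=> a F G; have [f ->] := LspaceP F; have [g ->] := LspaceP G.
by rewrite -class_LspaceD !scaleE scalerDr class_LspaceD.
Qed.

Let scaleDl F : {morph scale^~ F : a b / a + b}.
Proof.
by move=> a b; have [f ->] := LspaceP F; rewrite !scaleE scalerDl class_LspaceD.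
Qed.

HB.instance Definition _ :=
  GRing.Zmodule_isLmodule.Build R (LspaceType mu p1)
    scaleA scale1 scaleDr scaleDl.

Lemma class_LspaceZ a f : class_Lspace (a *: f) = a *: class_Lspace f.
Proof. by rewrite -scaleE. Qed.

Let norm F : R := fine ('N[mu]_p[EFin \o (F : T -> R)])%E.

Let normE f : norm (class_Lspace f) = fine ('N[mu]_p[EFin \o f])%E.
Proof.
congr fine.
exact: (@ae_eq_Lnorm (repr_Lspace (class_Lspace f)) f (class_LspaceE f)).
Qed.

Let ler_norm_add F G : norm (F + G) <= norm F + norm G.
Proof.
have [f ->] := LspaceP F; have [g ->] := LspaceP G.
by rewrite -class_LspaceD !normE; exact: ler_LnormD.
Qed.

Let norm_scale (a : R) F : norm (a *: F) = `|a| * norm F.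
Proof.
have [f ->] := LspaceP F; rewrite -class_LspaceZ !normE.
apply: EFin_inj; rewrite EFinM !finite_norm_fine; exact: LnormZ.
Qed.

Let norm_eq0 F : norm F = 0 -> F = 0.
Proof.
have [f ->] := LspaceP F; rewrite normE => /fine_Lnormr_eq0 f0.
by rewrite -class_Lspace0; apply/class_Lspace_eqP.
Qed.

HB.instance Definition _ :=
  Lmodule_isNormed.Build R (LspaceType mu p1)
    ler_norm_add norm_scale norm_eq0.

Lemma norm_LspaceE F : `|F|%:E = ('N[mu]_p[EFin \o (F : T -> R)])%E.
Proof. exact: (finite_norm_fine (repr_Lspace F)). Qed.

Lemma norm_class_Lspace f : `|class_Lspace f|%:E = ('N[mu]_p[EFin \o f])%E.
Proof. by rewrite -finite_norm_fine; congr EFin; exact: normE. Qed.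

Lemma repr_LspaceD F G : (F + G : T -> R) = F \+ G %[ae mu].
Proof. exact: (class_LspaceE (repr_Lspace F + repr_Lspace G)). Qed.

Lemma repr_LspaceZ (a : R) F : (a *: F : T -> R) = a \*: (F : T -> R) %[ae mu].
Proof. exact: (class_LspaceE (a *: repr_Lspace F)). Qed.

End Lspace_normed_module.

Lemma norm_Lspace1E d (T : measurableType d) (R : realType)
    (mu : {measure set T -> \bar R}) (F : LspaceType1 mu) :
  `|F|%:E = (\int[mu]_x `|((F : T -> R) x)%:E|)%E.
Proof. by rewrite norm_LspaceE Lnorm1. Qed.

Definition weakly_cvg (R : realType) (V : normedModType R) (u : V ^nat)
    (l : V) :=
  forall v : {linear V -> R^o}, continuous v ->
    v (u n - l) @[n --> \oo] --> (0 : R^o).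

(* Sequences are indexed from 0, so that the j-th Cesaro mean is over the indices
   k < j; its (irrelevant) value at j = 0 is 0, as [0^-1 = 0]. *)
Definition weak_banach_saks (R : realType) (V : normedModType R) :=
  forall (u : V ^nat) (l : V), weakly_cvg u l ->
  exists2 n_ : nat -> nat, {homo n_ : i j / (i < j)%N} &
    `|j%:R^-1 *: (\sum_(k < j) u (n_ k)) - l| @[j --> \oo] --> (0 : R).

(* Main.v *)
From HB Require Import structures.
Require Import Defs.
From mathcomp Require Import all_boot all_order all_algebra.
From mathcomp Require Import all_classical all_reals all_analysis.
From mathcomp Require Import measurable_realfun.
From mathcomp Require Import zify ring lra.

Set Implicit Arguments.
Unset Strict Implicit.
Unset Printing Implicit Defensive.

Import Order.TTheory GRing.Theory Num.Theory.
Import numFieldNormedType.Exports.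

Local Open Scope classical_set_scope.
Local Open Scope ring_scope.

(** Weak convergence in L^1 gives two things: uniform integrability, and
    decay of the pairing with each fixed bounded function. After subtracting
    the limit, let [f_n] be weakly null.

    Uniform integrability. Give the unit ball of bounded measurable functions
    the topology of the seminorms [v |-> int |v| |f_i|]. A gliding hump
    argument (the Baire category theorem unrolled along one sequence) produces
    a ball of this topology on which the functionals [v |-> int v f_n] are all
    small for [n] large ([gliding_hump]). Perturbing the centre of that ball
    by multiples of the sign of [f_n] turns this into a bound on [int t |f_n|]
    for weights [t] of small integral against [|f_0| + ... + |f_(M-1)|]
    ([weakly_null_equicontinuous]). Constant weights give boundedness, and
    indicators give truncation: up to an error [e] in L^1, every [f_n] is
    dominated by one integrable function [w] ([weakly_null_truncation]). The
    dominating function is a multiple of a finite sum of [|f_i|], so the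
    measure may be arbitrary.

    Cesaro means. Functions bounded by [w] live in the Hilbert space with
    inner product [int p q / w], whose norm controls the L^1 norm because [w]
    is integrable. An ultrafilter gives one subsequence along which, for every
    level [e = 1/(m+1)] at once, the Gram matrices of the truncations have a
    double limit ([double_limit_subsequence]). Averages of such a sequence are
    Cauchy in the Hilbert space ([average_Cauchy]), so the Cesaro means of the
    subsequence are Cauchy in L^1 up to every [e], hence Cauchy
    ([weakly_null_average_Cauchy]).

    Conclusion. The Cesaro means are also weakly null, and a Cauchy sequence
    that is weakly null tends to 0 in norm: pairing a late term with its own
    sign gives its norm, and the same sign pairs to nearly 0 with all much
    later terms, which are close to it ([weakly_null_Cauchy_cvg]). Completeness
    of L^1 and weak compactness in L^2 are thereby avoided. *)

(** * Sequences of indices and of reals *)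

Lemma increasing_leq (n_ : nat -> nat) : (forall k, (n_ k < n_ k.+1)%N) ->
  forall j k, (n_ j + k <= n_ (j + k))%N.
Proof.
move=> nS j; elim=> [|k IH]; first by rewrite !addn0.
by rewrite !addnS (leq_ltn_trans IH).
Qed.

Lemma increasing_geq_id (n_ : nat -> nat) : (forall k, (n_ k < n_ k.+1)%N) ->
  forall k, (k <= n_ k)%N.
Proof. by move=> nS k; rewrite (leq_trans _ (increasing_leq nS 0 k))// leq_addl. Qed.

Lemma sum_half_expS (R : realType) m n :
  \sum_(0 <= k < n) (2^-1 : R) ^+ (m + k).+1 = 2^-1 ^+ m - 2^-1 ^+ (m + n).
Proof.
elim: n => [|n IH]; first by rewrite big_geq// addn0 subrr.
rewrite big_nat_recr//= IH addnS exprS; lra.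
Qed.

Lemma limn_sup_bounds (R : realType) (u : nat -> R) (j : nat) (c a b : R) :
  (forall n, `|u n| <= c) -> (forall n, (j <= n)%N -> a <= u n <= b) ->
  a <= limn_sup u <= b.
Proof.
move=> uc uab.
have ub n : has_ubound (sdrop u n).
  by exists c => _ [m _ <-]; rewrite (le_trans (ler_norm _)).
have lbs : has_lbound (range (sups u)).
  exists (- c) => _ [n _ <-]; apply: (@le_trans _ _ (u n)).
    by have := uc n; rewrite ler_norml => /andP[].
  by apply: ub_le_sup => //; exists n => /=.
have -> : limn_sup u = inf (range (sups u)).
  apply: limn_supE; exists c; split; first exact: num_real.
  by move=> x cx n _ /=; rewrite (le_trans (uc n))// ltW.
apply/andP; split.
  apply: lb_le_inf; first by exists (sups u 0%N); exists 0%N.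
  move=> _ [n _ <-]; apply: (@le_trans _ _ (u (maxn n j))).
    by have /andP[] := uab (maxn n j) (leq_maxr _ _).
  by apply: ub_le_sup => //; exists (maxn n j) => //=; exact: leq_maxl.
apply: (@le_trans _ _ (sups u j)); first by apply: ge_inf => //; exists j.
apply: ge_sup; first by exists (u j); exists j => /=.
by move=> _ [m jm <-]; have /andP[] := uab m jm.
Qed.

(** No convergence of [u] is assumed: where the series diverges the bound is
    infinite, which is what lets an upper limit be taken at every point without
    discussing where it is a limit. *)
Lemma limn_sup_dist (R : realType) (u : nat -> R) (j : nat) (c : R) :
  (forall n, `|u n| <= c) ->
  (`|limn_sup u - u j|%:E <=
     \sum_(0 <= k <oo) `|u (j + k).+1 - u (j + k)%N|%:E)%E.
Proof.
move=> uc; set s := (X in (_ <= X)%E).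
have s0 : (0 <= s)%E by apply: nneseries_ge0 => k _ _; rewrite lee_fin.
case: (boolP (s \is a fin_num)) => [sfin|]; last first.
  by rewrite ge0_fin_numE// -leNgt leye_eq => /eqP ->; rewrite leey.
rewrite -(fineK sfin) lee_fin; set r := fine s.
have ujr m : (j <= m)%N -> `|u m - u j| <= r.
  move=> jm; rewrite -(subnKC jm); move: (m - j)%N => l.
  have -> : u (j + l)%N - u j = \sum_(0 <= k < l) (u (j + k).+1 - u (j + k)%N).
    rewrite (@telescope_sumr_eq _ 0%N l (fun k => u (j + k)%N)) ?addn0//.
    by move=> k _; rewrite addnS.
  rewrite -lee_fin (fineK sfin).
  apply: (@le_trans _ _ (\sum_(0 <= k < l) `|u (j + k).+1 - u (j + k)%N|%:E)%E).
    by rewrite sumEFin lee_fin ler_norm_sum.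
  by apply: nneseries_lim_ge => k _ _; rewrite lee_fin.
rewrite ler_distl; apply: (limn_sup_bounds uc (j := j)) => n /ujr.
by rewrite ler_distl.
Qed.

(** * Real-valued integrable functions *)

Section integration.
Context d (X : measurableType d) (R : realType).
Variable mu : {measure set X -> \bar R}.
Implicit Types (f g h v w : X -> R).

Notation L1 f := (mu.-integrable setT (EFin \o f)).
Notation Int f := (\int[mu]_x f x).

Lemma L1_measurable f : L1 f -> measurable_fun setT f.
Proof. by move=> /(measurable_int mu)/measurable_EFinP. Qed.

Lemma L1_le f g : measurable_fun setT f -> (forall x, `|f x| <= `|g x|) ->
  L1 g -> L1 f.
Proof.
move=> mf fg; apply: le_integrable => //; first exact/measurable_EFinP.
by move=> x _ /=; rewrite lee_fin.
Qed.

Lemma L1_norm f : L1 f -> L1 (fun x => `|f x|).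
Proof. exact: integrable_norm. Qed.

Lemma L1D f g : L1 f -> L1 g -> L1 (fun x => f x + g x).
Proof. by move=> lf lg; exact: (integrableD measurableT lf lg). Qed.

Lemma L1B f g : L1 f -> L1 g -> L1 (fun x => f x - g x).
Proof. by move=> lf lg; exact: (integrableB measurableT lf lg). Qed.

Lemma L1Z a f : L1 f -> L1 (fun x => a * f x).
Proof. by move=> lf; exact: (integrableZl measurableT a lf). Qed.

Lemma L1_bounded c v f : measurable_fun setT v -> (forall x, `|v x| <= c) ->
  L1 f -> L1 (fun x => v x * f x).
Proof.
move=> mv vc lf; apply: (L1_le _ _ (L1Z c lf)).
  by apply: measurable_funM => //; exact: L1_measurable.
move=> x; rewrite !normrM ler_wpM2r//.
by rewrite (le_trans (vc x))// ler_norm.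
Qed.

Lemma L1_sum n (F : nat -> X -> R) : (forall i, L1 (F i)) ->
  L1 (fun x => \sum_(i < n) F i x).
Proof.
move=> lF; rewrite (_ : _ \o _ = (fun x => \sum_(i < n) (F i x)%:E)%E).
  by apply: integrable_sum => // i _; exact: lF.
by apply/funext => x /=; rewrite sumEFin.
Qed.

Lemma Int_sum n (F : nat -> X -> R) : (forall i, L1 (F i)) ->
  Int (fun x => \sum_(i < n) F i x) = \sum_(i < n) Int (F i).
Proof.
move=> lF; elim: n => [|n IH].
  rewrite big_ord0 (_ : (fun x => _) = cst 0); last first.
    by apply/funext => x; rewrite big_ord0.
  by rewrite /Rintegral integral0.
rewrite big_ord_recr/= -IH -RintegralD//; last exact: L1_sum.
by congr Rintegral; apply/funext => x; rewrite big_ord_recr.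
Qed.

Lemma ler_Int f g : L1 f -> L1 g -> (forall x, f x <= g x) -> Int f <= Int g.
Proof. by move=> lf lg fg; exact: le_Rintegral. Qed.

Lemma Int_norm_le f g : measurable_fun setT f -> L1 g ->
  (forall x, `|f x| <= g x) -> `|Int f| <= Int g.
Proof.
move=> mf lg fg.
have lf : L1 f.
  by apply: L1_le lg => // x; rewrite (le_trans (fg x))// ler_norm.
by rewrite (le_trans (le_normr_Rintegral _ lf))//; apply: ler_Int => //; exact: L1_norm.
Qed.

End integration.

(** * The gliding hump *)

Section gliding_hump.
Context d (X : measurableType d) (R : realType).
Variable mu : {measure set X -> \bar R}.
Implicit Types (f g h v w : X -> R).

Notation L1 f := (mu.-integrable setT (EFin \o f)).
Notation Int f := (\int[mu]_x f x).

(** Only the unit ball of L^infty is used as test functions: the pairing is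
    homogeneous, and the gliding hump needs the uniform bound. *)
Definition Linfty_ball v := measurable_fun setT v /\ forall x, `|v x| <= 1.

Lemma Linfty_ball_L1 v f : Linfty_ball v -> L1 f -> L1 (fun x => v x * f x).
Proof. by move=> [mv v1]; exact: L1_bounded. Qed.

Lemma L1_dist_weight v w f : Linfty_ball v -> Linfty_ball w -> L1 f ->
  L1 (fun x => `|v x - w x| * `|f x|).
Proof.
move=> [mv v1] [mw w1] lf; apply: (@L1_bounded _ _ _ _ 2).
- by apply: measurableT_comp => //; exact: measurable_funB.
- by move=> x; rewrite normr_id (le_trans (ler_normB _ _))// (lerD (v1 x) (w1 x)).
- exact: L1_norm.
Qed.

Lemma limn_sup_Linfty_ball (w : nat -> X -> R) : (forall k, Linfty_ball (w k)) ->
  Linfty_ball (fun x => limn_sup (w ^~ x)).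
Proof.
move=> Sw; have wb t n : - 1 <= w n t <= 1 by rewrite -ler_norml; have [] := Sw n.
split.
  apply: measurable_fun_limn_sup => [t _|t _|n]; last by have [] := Sw n.
  - by exists 1 => _ [n _ <-]; have /andP[] := wb t n.
  - by exists (- 1) => _ [n _ <-]; have /andP[] := wb t n.
move=> t; rewrite ler_norml; apply: (@limn_sup_bounds _ _ 0%N 1) => n; first by have [] := Sw n.
by move=> _; exact: wb.
Qed.

(** Steps that are summable in the seminorm of [f] keep the upper limit within
    the sum of the remaining steps. *)
Lemma Int_limn_sup_dist (w : nat -> X -> R) f j (b : nat -> R) (B : R) :
  (forall k, Linfty_ball (w k)) -> L1 f ->
  (forall k, Int (fun x => `|w (j + k).+1 x - w (j + k)%N x| * `|f x|) <= b k) ->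
  (forall n, \sum_(0 <= k < n) b k <= B) ->
  Int (fun x => `|limn_sup (w ^~ x) - w j x| * `|f x|) <= B.
Proof.
move=> Sw lf wb bB.
have B0 : 0 <= B by have := bB 0%N; rewrite big_geq.
rewrite /Rintegral -[leRHS]/(fine B%:E).
have F0 k x : 0 <= `|w (j + k).+1 x - w (j + k)%N x| * `|f x| by rewrite mulr_ge0.
have mF k : measurable_fun setT (fun x => (`|w (j + k).+1 x - w (j + k)%N x| * `|f x|)%:E).
  apply/measurable_EFinP; apply: L1_measurable; exact: L1_dist_weight.
have Sv := limn_sup_Linfty_ball Sw.
have H : (\int[mu]_x (`|limn_sup (w ^~ x) - w j x| * `|f x|)%:E <= B%:E)%E.
  apply: (@le_trans _ _ (\int[mu]_x (\sum_(0 <= k <oo)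
      (`|w (j + k).+1 x - w (j + k)%N x| * `|f x|)%:E))%E).
    apply: ge0_le_integral => //.
    - by apply/measurable_EFinP; apply: L1_measurable; exact: L1_dist_weight.
    - by apply: ge0_emeasurable_sum => // k x _ _; rewrite lee_fin.
    - move=> x _; under eq_eseriesr do rewrite EFinM muleC.
      rewrite nneseriesZl//.
      rewrite [X in (X%:E <= _)%E]mulrC EFinM; apply: lee_wpmul2l => //.
      apply: (limn_sup_dist _ (c := 1)) => n; by have [_] := Sw n.
  rewrite integral_nneseries//.
  apply: lime_le.
    by apply: is_cvg_nneseries => k _ _; exact: integral_ge0.
  apply: nearW => n; apply: (@le_trans _ _ (\sum_(0 <= k < n) (b k)%:E)%E).
    apply: lee_sum => k _.
    rewrite -[leLHS]fineK; first by rewrite lee_fin; exact: wb.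
    by apply: integrable_fin_num => //; exact: L1_dist_weight.
  by rewrite sumEFin lee_fin.
apply: fine_le => //.
by rewrite ge0_fin_numE ?integral_ge0// (le_lt_trans H) ?ltry.
Qed.

Definition weakly_null (f : nat -> X -> R) := forall v, Linfty_ball v ->
  Int (fun x => v x * f n x) @[n --> \oo] --> (0 : R).

(** If the conclusion failed, every centre [v0] and every [M] would have a
    perturbation [v] of [v0], invisible to [f_0, ..., f_(M-1)], with
    [|int v f_n| > e] for some [n >= M]. Iterating with [M] beyond the last
    index used yields [w_k] and [n_k]; the steps after stage [j] change the
    pairing with [f_(n_j)] by at most [2^-j], so the upper limit of the [w_k]
    pairs with all late [f_(n_j)] to more than [e / 2], against weak
    nullity. *)
Lemma gliding_hump (f : nat -> X -> R) : (forall n, L1 (f n)) ->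
  weakly_null f -> forall e, 0 < e ->
  exists M v0, Linfty_ball v0 /\ forall n v, (M <= n)%N -> Linfty_ball v ->
    (forall i, (i < M)%N -> Int (fun x => `|v x - v0 x| * `|f i x|) <= 2^-1 ^+ M) ->
    `|Int (fun x => v x * f n x)| <= e.
Proof.
move=> lf f0 e e0; apply: contrapT => H.
have {}H M v0 : Linfty_ball v0 -> exists n v, [/\ (M <= n)%N, Linfty_ball v,
    (forall i, (i < M)%N -> Int (fun x => `|v x - v0 x| * `|f i x|) <= 2^-1 ^+ M) &
    e < `|Int (fun x => v x * f n x)|].
  move=> Sv0; apply: contrapT => H'; apply: H; exists M, v0; split => // n v Mn Sv vv0.
  by rewrite leNgt; apply/negP => ltv; apply: H'; exists n, v.
pose T := {s : (X -> R) * nat | Linfty_ball s.1}.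
pose step (s s' : T) := [/\ ((sval s).2 < (sval s').2)%N,
   (forall i, (i <= (sval s).2)%N -> Int (fun x => `|(sval s').1 x - (sval s).1 x|
      * `|f i x|) <= 2^-1 ^+ (sval s).2.+1) &
   e < `|Int (fun x => (sval s').1 x * f (sval s').2 x)|].
have stepP (s : T) : {s' : T | step s s'}.
  apply: cid; case: s => -[w n] /= Sw.
  have [n' [v [nn' Sv vw ev]]] := H n.+1 w Sw.
  by exists (exist _ (v, n') Sv); split.
have S0 : Linfty_ball (cst 0) by split => [|x]; [exact: measurable_cst|rewrite normr0].
have [s [_ sP]] := dependent_choice stepP (exist _ (cst 0, 0%N) S0).
pose w k := (sval (s k)).1; pose n_ k := (sval (s k)).2.
have Sw k : Linfty_ball (w k) := svalP (s k).
have nS k : (n_ k < n_ k.+1)%N by have [] := sP k.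
have n_ge := increasing_leq nS; have n_gid := increasing_geq_id nS.
pose v x := limn_sup (w ^~ x).
have Sv : Linfty_ball v by exact: limn_sup_Linfty_ball.
have vw j : Int (fun x => `|v x - w j x| * `|f (n_ j) x|) <= 2^-1 ^+ j.
  apply: (@Int_limn_sup_dist _ _ j (fun k => 2^-1 ^+ (j + k).+1)) => //.
    move=> k; have [_ + _] := sP (j + k)%N => /(_ (n_ j)).
    move=> /(_ _)/le_trans; apply.
      by rewrite (leq_trans _ (n_ge j k))// leq_addr.
    by apply: ler_wiXn2l; [lra|lra|exact: n_gid].
  by move=> n; rewrite sum_half_expS gerBl exprn_ge0.
have [J _ vJ] : \forall n \near \oo, `|Int (fun x => v x * f n x)| < e / 2.
  have /cvgr0Pnorm_lt := f0 v Sv; apply; lra.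
have [K _ hK] : \forall n \near \oo, 2^-1 ^+ n < e / 2 :> R.
  have /cvgr0Pnorm_lt/(_ (e / 2)) : 2^-1 ^+ n @[n --> \oo] --> (0 : R).
    apply: cvg_expr; rewrite ger0_norm; lra.
  move=> /(_ ltac:(lra)); apply: filterS => n.
  by rewrite ger0_norm// exprn_ge0.
pose j := (maxn J K).+1.
have /= vn : `|Int (fun x => v x * f (n_ j) x)| < e / 2.
  by apply: vJ => /=; rewrite (leq_trans _ (n_gid j))// leqW// leq_maxl.
have {}hK : 2^-1 ^+ j < e / 2 :> R by apply: hK => /=; rewrite leqW// leq_maxr.
have [_ _ ej] := sP (maxn J K); rewrite -/(w _) -/(n_ _) -/j in ej.
have : `|Int (fun x => v x * f (n_ j) x) - Int (fun x => w j x * f (n_ j) x)| <= 2^-1 ^+ j.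
  rewrite -RintegralB//; [|exact: Linfty_ball_L1..].
  rewrite (le_trans _ (vw j))//; apply: Int_norm_le.
  - apply: L1_measurable; apply: L1B; exact: Linfty_ball_L1.
  - exact: L1_dist_weight.
  - by move=> x; rewrite -mulrBl normrM.
rewrite distrC => /le_lt_trans/(_ hK) D.
have := lerB_dist (Int (fun x => w j x * f (n_ j) x)) (Int (fun x => v x * f (n_ j) x)).
lra.
Qed.

(** * Uniform integrability of weakly null sequences *)

Lemma Linfty_sign f : measurable_fun setT f ->
  exists2 s, Linfty_ball s & forall x, s x * f x = `|f x|.
Proof.
move=> mf; exists (fun x => if 0 <= f x then 1 else -1).
  split; last by move=> x; case: ifP; rewrite ?normrN normr1.
  by apply: measurable_fun_ifT => //; exact: measurable_fun_ler.
move=> x; case: (leP 0 (f x)) => fx; first by rewrite mul1r ger0_norm.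
by rewrite mulN1r ltr0_norm.
Qed.

(** With [v0] the centre given by [gliding_hump] and [s] the sign of [f_n], both
    functions [(1 - t) v0 + t s] and [(1 - t) v0 - t s] lie in the good
    neighbourhood, and their pairings with [f_n] differ by
    [2 int t |f_n|]. *)
Lemma weakly_null_equicontinuous (f : nat -> X -> R) : (forall n, L1 (f n)) ->
  weakly_null f -> forall e, 0 < e ->
  exists M, forall n (t : X -> R), (M <= n)%N -> measurable_fun setT t ->
    (forall x, 0 <= t x <= 1) ->
    Int (fun x => t x * \sum_(i < M) `|f i x|) <= 2^-1 ^+ M.+1 ->
    Int (fun x => t x * `|f n x|) <= e.
Proof.
move=> lf f0 e e0.
have [M [v0 [[mv0 v01] HM]]] := gliding_hump lf f0 e0.
exists M => n t Mn mt t01 th.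
have mf i := L1_measurable (lf i).
have [s [ms s1] sf] := Linfty_sign (mf n).
have t1 x : `|t x| <= 1 by have /andP[t0 ?] := t01 x; rewrite ger0_norm.
(* [b] is 1 or -1 *)
pose v (b : R) x := v0 x + t x * (b * s x - v0 x).
have mv b : measurable_fun setT (v b).
  apply: measurable_funD => //; apply: measurable_funM => //.
  by apply: measurable_funB => //; exact: measurable_funM.
have vball b : `|b| = 1 -> Linfty_ball (v b).
  move=> b1; split=> // x; have /andP[t0 tle1] := t01 x.
  have -> : v b x = (1 - t x) * v0 x + t x * (b * s x) by rewrite /v; ring.
  rewrite (le_trans (ler_normD _ _))// !normrM b1 mul1r.
  rewrite [`|1 - _|]ger0_norm ?subr_ge0// [`|t x|]ger0_norm//.
  have := v01 x; have := s1 x; nra.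
have lt i : L1 (fun x => t x * `|f i x|).
  by apply: L1_bounded t1 _ => //; exact: L1_norm.
have vi b i : `|b| = 1 -> (i < M)%N ->
    Int (fun x => `|v b x - v0 x| * `|f i x|) <= 2^-1 ^+ M.
  move=> b1 iM; have lth : L1 (fun x => t x * \sum_(i < M) `|f i x|).
    apply: L1_bounded t1 _ => //.
    by apply: (@L1_sum _ _ _ _ M (fun i x => `|f i x|)) => j; exact: L1_norm.
  apply: (@le_trans _ _ (Int (fun x => 2 * (t x * \sum_(i < M) `|f i x|)))).
    apply: ler_Int; [exact: L1_dist_weight (vball b b1) _ _|exact: L1Z|].
    move=> x; have /andP[t0 tle1] := t01 x.
    rewrite mulrA ler_pM//.
      rewrite /v addrC addKr normrM ger0_norm// mulrC ler_wpM2r//.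
      by rewrite (le_trans (ler_normB _ _))// normrM b1 mul1r (lerD (s1 x) (v01 x)).
    by rewrite (bigD1 (Ordinal iM))//= lerDl sumr_ge0.
  rewrite RintegralZl//; move: th; rewrite exprS; lra.
have E b : `|b| = 1 -> `|Int (fun x => v b x * f n x)| <= e.
  by move=> b1; apply: HM => //; [exact: vball|move=> i; exact: vi].
have n1 : `|1 : R| = 1 by rewrite normr1.
have nN1 : `|- 1 : R| = 1 by rewrite normrN1.
have : Int (fun x => v 1 x * f n x) - Int (fun x => v (- 1) x * f n x) =
    2 * Int (fun x => t x * `|f n x|).
  rewrite -RintegralB//; [|exact: Linfty_ball_L1 (vball _ _) _..].
  rewrite -RintegralZl//; apply: eq_Rintegral => x _.
  by rewrite -sf /v; ring.
have := E _ n1; have := E _ nN1; rewrite !ler_norml => /andP[? ?] /andP[? ?]; lra.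
Qed.

(** A small constant weight has small integral against the fixed integrable
    function of [weakly_null_equicontinuous]. *)
Lemma weakly_null_bounded (f : nat -> X -> R) : (forall n, L1 (f n)) ->
  weakly_null f -> exists M C, forall n, (M <= n)%N -> Int (fun x => `|f n x|) <= C.
Proof.
move=> lf f0; have [M HM] := weakly_null_equicontinuous lf f0 ltr01.
pose H := Int (fun x => \sum_(i < M) `|f i x|).
have H0 : 0 <= H by apply: Rintegral_ge0 => x _; exact: sumr_ge0.
have p0 : 0 < (2^-1 : R) ^+ M.+1 by rewrite exprn_gt0; lra.
have p1 : (2^-1 : R) ^+ M.+1 <= 1 by rewrite exprn_ile1; lra.
pose t := 2^-1 ^+ M.+1 / (H + 1).
have t0 : 0 < t by rewrite divr_gt0//; lra.
exists M, t^-1 => n Mn; rewrite -[leRHS]mul1r ler_pdivlMr// mulrC.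
rewrite -RintegralZl//; last exact: L1_norm.
apply: (HM n (cst t)) => //.
- by move=> x; rewrite /= (ltW t0)/= ler_pdivrMr; lra.
- rewrite RintegralZl//; last first.
    by apply: (@L1_sum _ _ _ _ M (fun i x => `|f i x|)) => j; exact: L1_norm.
  by rewrite -/H /t mulrAC ler_pdivrMr ?ler_wpM2l ?(ltW p0)//; lra.
Qed.

Definition truncation w f : X -> R := fun x => if `|f x| <= w x then f x else 0.

Lemma measurable_truncation w f : measurable_fun setT w -> measurable_fun setT f ->
  measurable_fun setT (truncation w f).
Proof.
move=> mw mf; apply: measurable_fun_ifT => //.
by apply: measurable_fun_ler => //; exact: measurableT_comp.
Qed.

Lemma truncation_le w f x : 0 <= w x -> `|truncation w f x| <= w x.
Proof. by rewrite /truncation; case: ifP => // _; rewrite normr0. Qed.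

(** Take [w = K h] with [h] a finite sum of [|f_i|]. On the set where
    [|f_n| > K h] the integral of [h] is at most [C / K] by boundedness, so for
    [K] large the indicator of that set is an admissible weight; the finitely
    many early [f_n] are already below [h]. *)
Lemma weakly_null_truncation (f : nat -> X -> R) : (forall n, L1 (f n)) ->
  weakly_null f -> forall e, 0 < e ->
  exists w, [/\ L1 w, forall x, 0 <= w x &
    forall n, Int (fun x => `|f n x - truncation w (f n) x|) <= e].
Proof.
move=> lf f0 e e0.
have [M HM] := weakly_null_equicontinuous lf f0 e0.
have [N [C HC]] := weakly_null_bounded lf f0.
have mf i := L1_measurable (lf i).
pose L := maxn M N; pose p : R := 2^-1 ^+ M.+1.
have p0 : 0 < p by rewrite exprn_gt0; lra.
(* chosen so that [K * p >= C], with room for [w >= h] *)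
pose K := 1 + `|C| / p.
have K1 : 1 <= K by rewrite /K lerDl divr_ge0// ltW.
pose h x := \sum_(i < L) `|f i x|.
have lh : L1 h by apply: (@L1_sum _ _ _ _ L (fun i x => `|f i x|)) => j; exact: L1_norm.
have h0 x : 0 <= h x by exact: sumr_ge0.
have hM x : \sum_(i < M) `|f i x| <= h x.
  rewrite /h -!(big_mkord xpredT (fun i => `|f i x|)).
  by rewrite [leRHS](@big_cat_nat _ _ _ M)//= ?leq_maxl// lerDl sumr_ge0.
pose w x := K * h x.
have w0 x : 0 <= w x by rewrite mulr_ge0//; lra.
have mw : measurable_fun setT w by exact: L1_measurable (L1Z _ lh).
exists w; split => //; first exact: L1Z.
move=> n; have [nL|Ln] := ltnP n L.
  rewrite (_ : (fun x => _) = cst 0) ?/Rintegral ?integral0 ?ltW//.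
  apply/funext => x; rewrite /truncation ifT ?subrr ?normr0//.
  have : `|f n x| <= h x by rewrite /h (bigD1 (Ordinal nL))//= lerDl sumr_ge0.
  by move=> fh; rewrite (le_trans fh)// ler_peMl.
pose t x : R := if `|f n x| <= w x then 0 else 1.
have mt : measurable_fun setT t.
  apply: measurable_fun_ifT => //.
  by apply: measurable_fun_ler => //; exact: measurableT_comp.
have t01 x : 0 <= t x <= 1 by rewrite /t; case: ifP => _; rewrite ?lexx ?ler01.
have t1 x : `|t x| <= 1 by have /andP[t0 ?] := t01 x; rewrite ger0_norm.
have -> : (fun x => `|f n x - truncation w (f n) x|) = (fun x => t x * `|f n x|).
  apply/funext => x; rewrite /truncation /t; case: ifP => _.
    by rewrite subrr mul0r normr0.
  by rewrite subr0 mul1r.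
have lth : L1 (fun x => t x * h x) by apply: L1_bounded t1 _.
apply: HM => //; first by rewrite (leq_trans _ Ln)// leq_maxl.
apply: (@le_trans _ _ (Int (fun x => t x * h x))).
  apply: ler_Int => //.
    apply: L1_bounded t1 _ => //.
    by apply: (@L1_sum _ _ _ _ M (fun i x => `|f i x|)) => j; exact: L1_norm.
  by move=> x; rewrite ler_wpM2l//; have /andP[] := t01 x.
have : K * Int (fun x => t x * h x) <= `|C|.
  rewrite -RintegralZl//; apply: (@le_trans _ _ (Int (fun x => `|f n x|))).
    apply: ler_Int; [exact: L1Z|exact: L1_norm|move=> x].
    rewrite /t; case: (leP `|f n x| (w x)) => [_|/ltW wf].
      by rewrite mul0r mulr0.
    by rewrite mul1r.
  by rewrite (le_trans _ (ler_norm _))// HC// (leq_trans _ Ln)// leq_maxr.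
have Kp : K * p = p + `|C| by rewrite /K mulrDl mul1r -mulrA mulVf ?mulr1// gt_eqF.
rewrite -/p => KI; rewrite -(@ler_pM2l _ K); lra.
Qed.

End gliding_hump.

(** * Double limits along a subsequence *)

Lemma ultrafilter_bounded_lim (R : realType) (U : set_system nat) (u : nat -> R) c :
  UltraFilter U -> (forall n, `|u n| <= c) ->
  exists l, forall e, 0 < e -> U [set n | `|u n - l| <= e].
Proof.
move=> UU uc.
have [|l [_ ul]] := @segment_compact R (- c) c (u @ U) _.
  by apply: (@filterE _ U) => n /=; rewrite in_itv/= -ler_norml.
exists l => e e0; have [//|UC] := @in_ultra_setVsetC _ U [set n | `|u n - l| <= e] UU.
have [|x [/= xe /ltW lx]] := ul [set x | ~ (`|x - l| <= e)] (ball l e) UC.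
  exact: nbhsx_ballx.
by case: xe; rewrite distrC.
Qed.

Lemma filter_forall_le (T : Type) (F : set_system T) (P : nat -> set T) n :
  Filter F -> (forall m, F (P m)) -> F [set x | forall m, (m <= n)%N -> P m x].
Proof.
move=> FF FP; elim: n => [|n IH].
  by apply: filterS (FP 0%N) => x Px m; rewrite leqn0 => /eqP ->.
apply: filterS2 IH (FP n.+1) => x Px Pn m; rewrite leq_eqVlt => /predU1P[->//|].
exact: Px.
Qed.

(** Let [b m i] be the limit of [G m i k] in [k], and [a m] the limit of
    [b m i] in [i], along one free ultrafilter [U]. Each new index is picked in
    a set of [U] on which the finitely many constraints coming from smaller
    indices hold, so a single subsequence serves all [m]. *)
Lemma double_limit_subsequence (R : realType) (G : nat -> nat -> nat -> R) (c : nat -> R) :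
  (forall m i k, `|G m i k| <= c m) ->
  exists n_ (a : nat -> R), (forall k, (n_ k < n_ k.+1)%N) /\
    forall m i k, (m < i)%N -> (i < k)%N -> `|G m (n_ i) (n_ k) - a m| <= 2 / i%:R.
Proof.
move=> Gc.
have [U [UU ooU]] := @ultraFilterLemma nat \oo _.
have PU : ProperFilter U := @ultra_proper _ _ UU.
have FU : Filter U by case: PU.
have [b bP] : {b : nat -> nat -> R & forall m i e, 0 < e ->
    U [set k | `|G m i k - b m i| <= e]}.
  apply: cid; have [b bP] := choice (fun mi : nat * nat =>
    ultrafilter_bounded_lim UU (Gc mi.1 mi.2)).
  by exists (fun m i => b (m, i)) => m i; exact: bP (m, i).
have bc m i : `|b m i| <= c m + 1.
  have [k /= Gb] := filter_ex (bP m i 1 ltr01).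
  have := Gc m i k; move: Gb; rewrite !ler_norml => /andP[? ?] /andP[? ?].
  apply/andP; split; lra.
have [a aP] := choice (fun m => ultrafilter_bounded_lim UU (bc m)).
pose step n n' := [/\ (n < n')%N, forall m, (m <= n)%N -> `|b m n' - a m| <= n.+1%:R^-1 &
  forall m, (m <= n)%N -> forall i, (i <= n)%N -> `|G m i n' - b m i| <= n.+1%:R^-1].
have stepP n : {n' | step n n'}.
  apply: cid; have n0 : 0 < (n.+1%:R : R)^-1 by rewrite invr_gt0.
  have U1 : U [set n' | (n < n')%N] by apply: ooU; exists n.+1.
  have U2 := filter_forall_le n FU (fun m => aP m _ n0).
  have U3 := filter_forall_le n FU (fun m =>
    filter_forall_le n FU (fun i => bP m i _ n0)).
  have [n' [? [? ?]]] := filter_ex (filterI U1 (filterI U2 U3)).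
  by exists n'; split.
have [n_ [_ nP]] := dependent_choice stepP 0%N.
have nS k : (n_ k < n_ k.+1)%N by have [] := nP k.
have n_ge := increasing_leq nS; have n_gid := increasing_geq_id nS.
exists n_, a; split => // m [//|i] [//|k] mi ik.
have n_i : (i.+1%:R : R)^-1 >= (n_ i).+1%:R^-1 by rewrite lef_pV2 ?posrE// ler_nat ltnS.
have n_k : (i.+1%:R : R)^-1 >= (n_ k).+1%:R^-1.
  by rewrite lef_pV2 ?posrE// ler_nat ltnS (leq_trans _ (n_gid k))// ltnW.
have ik' : (n_ i.+1 <= n_ k)%N.
  by rewrite -(subnKC (ik : (i.+1 <= k)%N)) (leq_trans _ (n_ge _ _))// leq_addr.
have [_ /(_ m) ba _] := nP i; have [_ _ /(_ m)] := nP k.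
move=> /(_ _ (n_ i.+1) ik') Gb.
have {}ba : `|b m (n_ i.+1) - a m| <= (n_ i).+1%:R^-1.
  by apply: ba; rewrite (leq_trans _ (n_gid i)).
have {}Gb : `|G m (n_ i.+1) (n_ k.+1) - b m (n_ i.+1)| <= (n_ k).+1%:R^-1.
  by apply: Gb; rewrite (leq_trans _ (n_gid k))//; lia.
rewrite (le_trans (ler_distD (b m (n_ i.+1)) _ _))// [2 * _]mulr_natl mulr2n.
by apply: lerD; [exact: le_trans Gb n_k|exact: le_trans ba n_i].
Qed.

(** Among the [N * M] pairs, those at which [g] is far from [a] lie in two strips
    of width [J] or on the diagonal, a vanishing proportion. *)
Lemma double_average_cvg (R : realType) (g : nat -> nat -> R) (a c : R) :
  (forall i k, g i k = g k i) -> (forall i k, `|g i k| <= c) ->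
  (forall e, 0 < e -> exists J, forall i k, (J <= i)%N -> (i < k)%N -> `|g i k - a| <= e) ->
  forall e, 0 < e -> exists J, forall N M, (J <= N)%N -> (J <= M)%N ->
    `|N%:R^-1 * (M%:R^-1 * \sum_(i < N) \sum_(k < M) g i k) - a| <= e.
Proof.
move=> gC gc ga e e0.
have e20 : 0 < e / 2 by rewrite divr_gt0.
have [J gJ] := ga _ e20.
pose D := c + `|a|.
have D0 : 0 <= D by rewrite addr_ge0// (le_trans _ (gc 0%N 0%N)).
have gaD i k : `|g i k - a| <= D by rewrite (le_trans (ler_normB _ _))// lerD.
have gE i k : `|g i k - a| <= e / 2 + D * ((i < J)%:R + (k < J)%:R + (i == k)%:R).
  have bad (S : R) : 1 <= S -> `|g i k - a| <= e / 2 + D * S.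
    by move=> S1; rewrite (le_trans (gaD i k))// (le_trans (ler_peMr D0 S1))// lerDr ltW.
  have good (S : R) : 0 <= S -> `|g i k - a| <= e / 2 -> `|g i k - a| <= e / 2 + D * S.
    by move=> S0 /le_trans; apply; rewrite lerDl mulr_ge0.
  have [iJ|Ji] := ltnP i J; first by apply: bad; rewrite -!natrD ler1n.
  have [kJ|Jk] := ltnP k J; first by apply: bad; rewrite -!natrD ler1n.
  have [ik|ki|_] := ltngtP i k; last by apply: bad; rewrite -!natrD ler1n.
  - by apply: good; [rewrite -!natrD ler0n|exact: gJ].
  - by apply: good; [rewrite -!natrD ler0n|rewrite gC; exact: gJ].
have sJ N : \sum_(i < N) ((i < J)%:R : R) <= J%:R.
  suff -> : \sum_(i < N) ((i < J)%:R : R) = (minn N J)%:R by rewrite ler_nat geq_minr.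
  elim: N => [|N IH]; first by rewrite big_ord0 min0n.
  rewrite big_ord_recr/= IH -natrD; congr _%:R.
  by rewrite /minn; case: (ltnP N J) => /= ?; case: (ltnP N.+1 J) => ?; lia.
have sD N (k : nat) : \sum_(i < N) (((i : nat) == k)%:R : R) <= 1.
  suff -> : \sum_(i < N) (((i : nat) == k)%:R : R) = (k < N)%:R.
    by rewrite lern1 leq_b1.
  elim: N => [|N IH]; first by rewrite big_ord0.
  rewrite big_ord_recr/= IH -natrD ltnS; congr _%:R.
  by case: (ltngtP k N).
pose T := Num.bound (D * (J.+1%:R) / (e / 4)).
have TD : D * J.+1%:R < T%:R * (e / 4).
  rewrite -ltr_pdivrMr ?divr_gt0//; apply: archi_boundP.
  by rewrite !mulr_ge0// invr_ge0 ltW// divr_gt0.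
exists T.+1 => N M TN TM.
have N0 : 0 < N%:R :> R by rewrite ltr0n; lia.
have M0 : 0 < M%:R :> R by rewrite ltr0n; lia.
have TN' : T%:R <= N%:R :> R by rewrite ler_nat ltnW.
have TM' : T%:R <= M%:R :> R by rewrite ler_nat ltnW.
have -> : N%:R^-1 * (M%:R^-1 * \sum_(i < N) \sum_(k < M) g i k) - a =
    (N%:R * M%:R)^-1 * \sum_(i < N) \sum_(k < M) (g i k - a).
  have -> : \sum_(i < N) \sum_(k < M) (g i k - a) =
      \sum_(i < N) \sum_(k < M) g i k - N%:R * M%:R * a.
    under eq_bigr do rewrite sumrB sumr_const card_ord.
    by rewrite sumrB sumr_const card_ord -natrM mulr_natl mulnC mulrnA.
  by field; rewrite !gt_eqF.
rewrite normrM gtr0_norm ?invr_gt0 ?mulr_gt0// ler_pdivrMl ?mulr_gt0//.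
apply: (@le_trans _ _ (\sum_(i < N) \sum_(k < M)
    (e / 2 + D * ((i < J)%:R + (k < J)%:R + (i == k :> nat)%:R)))).
  rewrite (le_trans (ler_norm_sum _ _ _))//; apply: ler_sum => i _.
  by rewrite (le_trans (ler_norm_sum _ _ _))//; apply: ler_sum => k _; exact: gE.
have -> : \sum_(i < N) \sum_(k < M)
    (e / 2 + D * ((i < J)%:R + (k < J)%:R + (i == k :> nat)%:R)) =
    N%:R * M%:R * (e / 2) + D * (M%:R * (\sum_(i < N) (i < J)%:R) +
     N%:R * (\sum_(k < M) (k < J)%:R) + \sum_(k < M) \sum_(i < N) (i == k :> nat)%:R).
  rewrite [in RHS]exchange_big/=.
  have cstE n (x : R) : \sum_(i < n) x = n%:R * x.
    by rewrite sumr_const card_ord mulr_natl.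
  have inner (i : 'I_N) : \sum_(k < M) (e / 2 + D * ((i < J)%:R + (k < J)%:R + (i == k :> nat)%:R)) =
      M%:R * (e / 2) + D * (M%:R * (i < J)%:R + \sum_(k < M) (k < J)%:R +
        \sum_(k < M) (i == k :> nat)%:R).
    by rewrite big_split/= cstE -mulr_sumr 2!big_split/= cstE.
  rewrite (eq_bigr _ (fun i _ => inner i)) big_split/= cstE -mulr_sumr 2!big_split/=.
  by rewrite cstE -mulr_sumr; ring.
have S1 := sJ N; have S2 := sJ M.
have S3 : \sum_(k < M) \sum_(i < N) (((i : nat) == k)%:R : R) <= M%:R.
  rewrite -[leRHS]mulr1 mulr_natl -[M in leRHS]card_ord -sumr_const.
  by apply: ler_sum => k _; exact: sD.
have J1 : (J.+1%:R : R) = J%:R + 1 by rewrite -addn1 natrD.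
have SS : M%:R * (\sum_(i < N) (i < J)%:R) +
     N%:R * (\sum_(k < M) (k < J)%:R) + \sum_(k < M) \sum_(i < N) (i == k :> nat)%:R
  <= (M%:R + N%:R) * J.+1%:R :> R.
  by rewrite J1; nra.
have DN : D * J.+1%:R <= N%:R * (e / 4) by nra.
have DM : D * J.+1%:R <= M%:R * (e / 4) by nra.
have : D * ((M%:R + N%:R) * J.+1%:R) <= N%:R * M%:R * (e / 2).
  by rewrite mulrCA mulrDl; nra.
have := ler_wpM2l D0 SS; lra.
Qed.

(** * Cesaro means *)

Section cesaro_means.
Context d (X : measurableType d) (R : realType).
Variable mu : {measure set X -> \bar R}.
Implicit Types (f g h : nat -> X -> R) (w : X -> R).

Notation L1 f := (mu.-integrable setT (EFin \o f)).
Notation Int f := (\int[mu]_x f x).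

Definition average f n : X -> R := fun x => n%:R^-1 * \sum_(k < n) f k x.

Lemma L1_average f n : (forall k, L1 (f k)) -> L1 (average f n).
Proof. by move=> lf; apply: L1Z; exact: L1_sum. Qed.

Lemma average_norm_le (u : nat -> R) c n : 0 <= c -> (forall k, `|u k| <= c) ->
  `|n%:R^-1 * \sum_(k < n) u k| <= c.
Proof.
move=> c0 uc; rewrite normrM normfV normr_nat.
case: n => [|n]; first by rewrite invr0 mul0r.
rewrite ler_pdivrMl// (le_trans (ler_norm_sum _ _ _))//.
rewrite mulr_natl -[n.+1 in leRHS]card_ord -sumr_const.
exact: ler_sum.
Qed.

Lemma Int_norm_average_le f c n : (forall k, L1 (f k)) -> 0 <= c ->
  (forall k, Int (fun x => `|f k x|) <= c) -> Int (fun x => `|average f n x|) <= c.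
Proof.
move=> lf c0 fc; have lnf k : L1 (fun x => `|f k x|) by exact: L1_norm.
apply: (@le_trans _ _ (Int (average (fun k x => `|f k x|) n))).
  apply: ler_Int; [exact/L1_norm/L1_average|exact: L1_average|move=> x].
  by rewrite /average normrM normfV normr_nat ler_wpM2l ?invr_ge0// ler_norm_sum.
rewrite RintegralZl//; last exact: (@L1_sum _ _ _ _ n (fun k x => `|f k x|)).
rewrite (@Int_sum _ _ _ mu n (fun k x => `|f k x|))//.
rewrite (le_trans (ler_norm _))//.
apply: (@average_norm_le (fun k => Int (fun x => `|f k x|))) => // k.
by rewrite ger0_norm// Rintegral_ge0.
Qed.

Section weighted_product.
Variables (w : X -> R).
Hypotheses (lw : L1 w) (w0 : forall x, 0 <= w x).

(** The form [int p q / w] makes the functions dominated by [w] part of a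
    Hilbert space, with norm at most that of [w]. Where [w] vanishes so do [p]
    and [q], and the integrand is 0 since [0^-1 = 0]. *)
Lemma L1_weighted_product (p q : X -> R) :
  measurable_fun setT p -> measurable_fun setT q ->
  (forall x, `|p x| <= w x) -> (forall x, `|q x| <= w x) ->
  L1 (fun x => p x * q x / w x) /\ `|Int (fun x => p x * q x / w x)| <= Int w.
Proof.
move=> mp mq pw qw.
have mV : measurable_fun setT (fun x => (w x)^-1).
  rewrite (_ : (fun x => _) = (fun x => w x `^ (-1))); last first.
    by apply/funext => x; rewrite powR_inv1.
  exact: (measurableT_comp (measurable_powR _) (L1_measurable lw)).
have mpq : measurable_fun setT (fun x => p x * q x / w x).
  by apply: measurable_funM => //; exact: measurable_funM.
have pqw x : `|p x * q x / w x| <= w x.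
  rewrite !normrM normfV (ger0_norm (w0 x)).
  have [wx0|wx0] := eqVneq (w x) 0; first by rewrite wx0 invr0 mulr0.
  have wx : 0 < w x by rewrite lt_neqAle eq_sym wx0/=.
  by rewrite ler_pdivrMr// ler_pM.
split; last exact: Int_norm_le.
by apply: L1_le mpq _ lw => x; rewrite (le_trans (pqw x))// ler_norm.
Qed.

(** Expanding the square, [int (A_N - A_M)^2 / w] is a combination of double
    averages of the Gram matrix that converge to [a - 2 a + a = 0]. The
    pointwise bound [|z| <= t w + z^2 / (t w)] converts this into smallness of
    [int |A_N - A_M|]. *)
Lemma average_Cauchy g (a : R) : (forall k, measurable_fun setT (g k)) ->
  (forall k x, `|g k x| <= w x) ->
  (forall e, 0 < e -> exists J, forall i k, (J <= i)%N -> (i < k)%N ->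
     `|Int (fun x => g i x * g k x / w x) - a| <= e) ->
  forall e, 0 < e -> exists J, forall N M, (J <= N)%N -> (J <= M)%N ->
    Int (fun x => `|average g N x - average g M x|) <= e.
Proof.
move=> mg gw ga e e0.
pose W := Int w; have W0 : 0 <= W by exact: Rintegral_ge0.
(* makes [t * W <= e / 2] *)
pose t := e / 2 / (W + 1).
have t0 : 0 < t by rewrite !divr_gt0//; lra.
have gP i k := L1_weighted_product (mg i) (mg k) (gw i) (gw k).
have [|||J HJ] := @double_average_cvg R
    (fun i k => Int (fun x => g i x * g k x / w x)) a W _ _ ga (e * t / 8).
- by move=> i k; congr Rintegral; apply/funext => x; rewrite (mulrC (g i x)).
- by move=> i k; have [] := gP i k.
- by rewrite divr_gt0// mulr_gt0.
exists J => N M JN JM.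
have lg k : L1 (g k).
  by apply: L1_le (mg k) _ lw => x; rewrite (le_trans (gw k x))// ler_norm.
have ma n : measurable_fun setT (average g n) by exact: L1_measurable (L1_average n lg).
have aw n x : `|average g n x| <= w x by exact: (@average_norm_le (g ^~ x)).
have aP n m := L1_weighted_product (ma n) (ma m) (aw n) (aw m).
have aE n m : Int (fun x => average g n x * average g m x / w x) =
    n%:R^-1 * (m%:R^-1 * \sum_(i < n) \sum_(k < m) Int (fun x => g i x * g k x / w x)).
  transitivity (Int (fun x => n%:R^-1 * (m%:R^-1 * \sum_(i < n) \sum_(k < m) g i x * g k x / w x))).
    congr Rintegral; apply/funext => x; rewrite /average mulrACA -!mulrA; congr (_ * (_ * _)).
    rewrite mulrA mulr_suml mulr_suml; apply: eq_bigr => i _.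
    by rewrite mulr_sumr mulr_suml.
  have ls i : L1 (fun x => \sum_(k < m) g i x * g k x / w x).
    by apply: (@L1_sum _ _ _ _ m (fun k x => g i x * g k x / w x)) => k; have [] := gP i k.
  have lss : L1 (fun x => \sum_(i < n) \sum_(k < m) g i x * g k x / w x).
    exact: (@L1_sum _ _ _ _ n (fun i x => \sum_(k < m) g i x * g k x / w x)).
  rewrite RintegralZl//; last exact: L1Z.
  rewrite RintegralZl// (@Int_sum _ _ _ mu n (fun i x => \sum_(k < m) g i x * g k x / w x))//.
  congr (_ * (_ * _)); apply: eq_bigr => i _.
  rewrite (@Int_sum _ _ _ mu m (fun k x => g i x * g k x / w x))// => k.
  by have [] := gP i k.
pose z x := average g N x - average g M x.
have zw x : `|z x| <= 2 * w x.
  by rewrite (le_trans (ler_normB _ _))// mulr_natl mulr2n lerD.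
have z2E x : z x * z x / w x = average g N x * average g N x / w x -
    (2 * (average g N x * average g M x / w x)) + average g M x * average g M x / w x.
  by rewrite /z; ring.
have [lNN _] := aP N N; have [lNM _] := aP N M; have [lMM _] := aP M M.
have lz2 : L1 (fun x => z x * z x / w x).
  rewrite (funext z2E).
  by apply: L1D => //; apply: L1B => //; exact: L1Z.
have Iz2 : Int (fun x => z x * z x / w x) <= e * t / 2.
  rewrite (funext z2E).
  rewrite RintegralD//; last by apply: L1B => //; exact: L1Z.
  rewrite RintegralB//; last exact: L1Z.
  rewrite RintegralZl// !aE.
  have := HJ N N JN JN; have := HJ N M JN JM; have := HJ M M JM JM.
  by rewrite !ler_norml => /andP[? ?] /andP[? ?] /andP[? ?]; lra.
apply: (@le_trans _ _ (Int (fun x => t * w x + t^-1 * (z x * z x / w x)))).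
  apply: ler_Int.
  - by apply: L1_norm; apply: L1B; exact: L1_average.
  - by apply: L1D; exact: L1Z.
  - move=> x; rewrite -/(z x); have := zw x.
    have [->|wx0] := eqVneq (w x) 0.
      by rewrite mulr0 invr0 !mulr0 add0r.
    have wx : 0 < t * w x by rewrite mulr_gt0// lt_neqAle eq_sym wx0/=.
    move=> _; have -> : t^-1 * (z x * z x / w x) = `|z x| * (`|z x| / (t * w x)).
      have -> : z x * z x = `|z x| * `|z x| by rewrite -normrM ger0_norm// -expr2 sqr_ge0.
      by field; rewrite wx0 gt_eqF.
    have [zt|/ltW tz] := leP `|z x| (t * w x).
      by rewrite (le_trans zt)// lerDl mulr_ge0// divr_ge0// ltW.
    apply: (@le_trans _ _ (`|z x| * (`|z x| / (t * w x)))); last by rewrite lerDr ltW.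
    by rewrite ler_peMr// ler_pdivlMr// mul1r.
rewrite RintegralD//; [|exact: L1Z..].
rewrite !RintegralZl// -/W.
have tW : t * W <= e / 2.
  by rewrite /t mulrAC ler_pdivrMr ?ler_wpM2l//; lra.
have : t^-1 * Int (fun x => z x * z x / w x) <= e / 2.
  by rewrite ler_pdivrMl//; lra.
lra.
Qed.

End weighted_product.

(** The truncations of level [m] stay within [1 / (m + 1)] of the sequence in
    L^1, and so do their averages; the averages of the truncations are Cauchy.
    The subsequence is the same for all [m]. *)
Lemma weakly_null_average_Cauchy f : (forall n, L1 (f n)) -> weakly_null mu f ->
  exists2 n_ : nat -> nat, (forall k, (n_ k < n_ k.+1)%N) &
  forall e, 0 < e -> exists J, forall N M, (J <= N)%N -> (J <= M)%N ->
    Int (fun x => `|average (f \o n_) N x - average (f \o n_) M x|) <= e.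
Proof.
move=> lf f0; have mf n := L1_measurable (lf n).
have [w wP] := choice (fun m : nat => weakly_null_truncation lf f0
  (ltac:(by rewrite invr_gt0) : 0 < (m.+1%:R : R)^-1)).
have lw m : L1 (w m) by have [] := wP m.
have w0 m : forall x, 0 <= w m x by have [] := wP m.
have mt m n : measurable_fun setT (truncation (w m) (f n)).
  by apply: measurable_truncation => //; exact: L1_measurable.
have tw m n x : `|truncation (w m) (f n) x| <= w m x by exact: truncation_le.
pose G m i k := Int (fun x => truncation (w m) (f i) x * truncation (w m) (f k) x / w m x).
have [|n_ [a [n_S Ga]]] := @double_limit_subsequence R G (fun m => Int (w m)).
  by move=> m i k; have [] := L1_weighted_product (lw m) (w0 m) (mt m i) (mt m k) (tw m i) (tw m k).
exists n_ => // e e0.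
pose m := Num.bound (4 / e).
have me : (m.+1%:R : R)^-1 <= e / 4.
  rewrite -[e / 4]invf_div lef_pV2 ?posrE ?divr_gt0// ltW//.
  by rewrite (lt_le_trans (archi_boundP (divr_ge0 _ (ltW e0))))// ler_nat.
pose g k := truncation (w m) (f (n_ k)).
have lg k : L1 (g k).
  by apply: L1_le (mt m _) _ (lw m) => x; rewrite (le_trans (tw _ _ _))// ler_norm.
have e20 : 0 < e / 2 by rewrite divr_gt0.
have [|||J HJ] := @average_Cauchy _ (lw m) (w0 m) g (a m) _ _ _ _ e20.
- by move=> k; exact: mt.
- by move=> k x; exact: tw.
- move=> r r0; pose J := Num.bound (2 / r).
  exists (maxn J m).+1 => i k Ji ik; apply: le_trans (Ga m i k _ ik) _.
    by rewrite (leq_ltn_trans _ Ji)// leq_maxr.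
  have i0 : 0 < i%:R :> R by rewrite ltr0n (leq_trans _ Ji).
  rewrite ler_pdivrMr// mulrC -ler_pdivrMr// ltW//.
  rewrite (lt_le_trans (archi_boundP (divr_ge0 _ (ltW r0))))// ler_nat.
  by rewrite (leq_trans _ (ltnW Ji))// leq_maxl.
exists J => N M JN JM.
pose h k x := f (n_ k) x - g k x.
have lh k : L1 (h k) by exact: L1B.
have ah n : Int (fun x => `|average h n x|) <= e / 4.
  apply: Int_norm_average_le => //; first by rewrite divr_ge0// ltW.
  by move=> k; rewrite (le_trans _ me)//; have [_ _] := wP m; exact.
have aE n x : average (f \o n_) n x = average g n x + average h n x.
  rewrite /average -mulrDr -big_split/=; congr (_ * _); apply: eq_bigr => k _.
  by rewrite /h addrC subrK.
have lag n : L1 (average g n) by exact: L1_average.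
have lah n : L1 (average h n) by exact: L1_average.
have laf n : L1 (average (f \o n_) n) by apply: L1_average => k; exact: lf.
apply: (@le_trans _ _ (Int (fun x => `|average g N x - average g M x| +
   (`|average h N x| + `|average h M x|)))).
  apply: ler_Int; [exact/L1_norm/L1B| |].
    by apply: L1D; [exact/L1_norm/L1B|apply: L1D; exact: L1_norm].
  move=> x; rewrite !aE opprD addrACA (le_trans (ler_normD _ _))// lerD2l.
  exact: ler_normB.
rewrite RintegralD//; [|exact/L1_norm/L1B|by apply: L1D; exact: L1_norm].
rewrite RintegralD//; [|exact: L1_norm..].
have := HJ N M JN JM; have := ah N; have := ah M; lra.
Qed.

Lemma weakly_null_subseq f (n_ : nat -> nat) : (forall k, (n_ k < n_ k.+1)%N) ->
  weakly_null mu f -> weakly_null mu (f \o n_).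
Proof.
move=> nS f0 v Sv.
apply/cvgr0Pnorm_lt => e e0; have /cvgr0Pnorm_lt/(_ e e0) [J _ HJ] := f0 v Sv.
by exists J => // k /= Jk; apply: HJ; exact: leq_trans (increasing_geq_id nS k).
Qed.

Lemma weakly_null_average f : (forall n, L1 (f n)) ->
  weakly_null mu f -> weakly_null mu (average f).
Proof.
move=> lf f0 v Sv; rewrite -(cvg_shiftS (fun n => Int (fun x => v x * average f n x))).
have /cesaro := f0 v Sv; apply: cvg_trans; apply: near_eq_cvg; apply: nearW => n.
have lvf k : L1 (fun x => v x * f k x) by exact: Linfty_ball_L1.
rewrite /arithmetic_mean /series/= big_mkord -(@Int_sum _ _ _ mu _ (fun k x => v x * f k x))//.
rewrite -RintegralZl//; last exact: (@L1_sum _ _ _ _ _ (fun k x => v x * f k x)).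
congr Rintegral; apply/funext => x; rewrite /average mulrCA; congr (_ * _).
by rewrite mulr_sumr.
Qed.

(** The norm of [f_M] is its pairing with its own sign [s], and
    [int s f_M = int s (f_M - f_N) + int s f_N] with both terms small for [N]
    large. *)
Lemma weakly_null_Cauchy_cvg f : (forall n, L1 (f n)) -> weakly_null mu f ->
  (forall e, 0 < e -> exists J, forall N M, (J <= N)%N -> (J <= M)%N ->
     Int (fun x => `|f N x - f M x|) <= e) ->
  Int (fun x => `|f n x|) @[n --> \oo] --> (0 : R).
Proof.
move=> lf f0 fC; apply/cvgr0Pnorm_le => e e0.
have e20 : 0 < e / 2 by rewrite divr_gt0.
have [J HJ] := fC _ e20; exists J => // M /= JM.
have [s Ss sf] := Linfty_sign (L1_measurable (lf M)).
have /cvgr0Pnorm_lt/(_ (e / 2) e20) [K _ HK] := f0 s Ss.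
pose N := maxn J K.
have /= sN : `|Int (fun x => s x * f N x)| < e / 2 by apply: HK => /=; exact: leq_maxr.
have lsf n : L1 (fun x => s x * f n x) by exact: Linfty_ball_L1.
have : `|Int (fun x => s x * f M x) - Int (fun x => s x * f N x)| <= e / 2.
  rewrite -RintegralB//.
  apply: le_trans (HJ M N JM (leq_maxl _ _)); apply: Int_norm_le.
  - by apply: L1_measurable; exact: L1B.
  - exact/L1_norm/L1B.
  - by move=> x; rewrite -mulrBr normrM ler_piMl//; have [] := Ss.
have -> : Int (fun x => s x * f M x) = Int (fun x => `|f M x|).
  by congr Rintegral; apply/funext.
rewrite [in X in _ -> X]ger0_norm; last by apply: Rintegral_ge0.
have := lerB_dist (Int (fun x => `|f M x|)) (Int (fun x => s x * f N x)).
rewrite [X in X - _ <= _]ger0_norm; last by apply: Rintegral_ge0.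
lra.
Qed.

Lemma weakly_null_banach_saks f : (forall n, L1 (f n)) -> weakly_null mu f ->
  exists2 n_ : nat -> nat, (forall k, (n_ k < n_ k.+1)%N) &
    Int (fun x => `|average (f \o n_) n x|) @[n --> \oo] --> (0 : R).
Proof.
move=> lf f0; have [n_ nS nC] := weakly_null_average_Cauchy lf f0.
have lfn k : L1 ((f \o n_) k) by exact: lf.
exists n_ => //; apply: weakly_null_Cauchy_cvg => // [n|].
  exact: L1_average.
by apply: weakly_null_average => //; exact: weakly_null_subseq.
Qed.

End cesaro_means.

(** * From functions to their classes *)

Section transfer_to_Lspace1.
Context d (X : measurableType d) (R : realType).
Variable mu : {measure set X -> \bar R}.
Implicit Types F G : LspaceType1 mu.

Lemma L1_repr F : mu.-integrable setT (EFin \o (F : X -> R)).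
Proof.
apply/integrableP; split; first exact/measurable_EFinP/repr_Lspace_measurable.
by rewrite -(norm_Lspace1E F) ltry.
Qed.

Lemma norm_Lspace1_Rintegral F : `|F| = \int[mu]_x `|(F : X -> R) x|.
Proof. by rewrite /Rintegral -[LHS]/(fine `|F|%:E) norm_Lspace1E. Qed.

Lemma eq_Rintegral_ae (f g : X -> R) : measurable_fun setT f ->
  measurable_fun setT g -> f = g %[ae mu] -> \int[mu]_x f x = \int[mu]_x g x.
Proof.
move=> mf mg fg; congr fine; apply: ae_eq_integral => //; [exact/measurable_EFinP..|].
by apply: filterS fg => x /= /[apply] ->.
Qed.

Section pairing.
Variable v : X -> R.
Hypothesis Sv : Linfty_ball v.

Definition pairing F : R^o := \int[mu]_x (v x * (F : X -> R) x).

Let measurable_pairing F : measurable_fun setT (fun x => v x * (F : X -> R) x).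
Proof. exact: L1_measurable (Linfty_ball_L1 Sv (L1_repr F)). Qed.

Let pairingD : {morph pairing : F G / F + G}.
Proof.
move=> F G; have lF := Linfty_ball_L1 Sv (L1_repr F).
have lG := Linfty_ball_L1 Sv (L1_repr G).
rewrite /pairing -RintegralD//; apply: eq_Rintegral_ae => //.
  exact: measurable_funD.
by apply: filterS (repr_LspaceD F G) => x /= /[apply] ->; rewrite mulrDr.
Qed.

Let pairingZ : scalable pairing.
Proof.
move=> a F; have lF := Linfty_ball_L1 Sv (L1_repr F).
rewrite /pairing -[RHS]RintegralZl//; apply: eq_Rintegral_ae => //.
  exact: measurable_funM.
by apply: filterS (repr_LspaceZ a F) => x /= /[apply] ->; rewrite mulrCA.
Qed.

Let pairing_is_linear : linear pairing.
Proof. by move=> a F G; rewrite pairingD pairingZ. Qed.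

Definition pairing_linear : {linear LspaceType1 mu -> R^o} :=
  HB.pack pairing (GRing.isLinear.Build _ _ _ _ pairing pairing_is_linear).

Lemma continuous_pairing : continuous pairing_linear.
Proof.
apply/linear_bounded_continuous/linear_boundedP; exists 1; split; first exact: num_real.
move=> r /ltW r1 F; apply: (@le_trans _ _ `|F|); last by rewrite ler_peMl.
rewrite norm_Lspace1_Rintegral; apply: Int_norm_le; [exact: measurable_pairing| |].
  exact/L1_norm/L1_repr.
by move=> x; rewrite normrM ler_piMl//; have [] := Sv.
Qed.

End pairing.

Lemma weakly_cvg_null (u : nat -> LspaceType1 mu) (l : LspaceType1 mu) :
  weakly_cvg u l -> weakly_null mu (fun n => ((u n - l : LspaceType1 mu) : X -> R)).
Proof. by move=> ul v Sv; exact: (ul (pairing_linear Sv) (@continuous_pairing v Sv)). Qed.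

Lemma repr_Lspace_sum (F : nat -> LspaceType1 mu) n :
  ((\sum_(k < n) F k : LspaceType1 mu) : X -> R) = (fun x => \sum_(k < n) (F k : X -> R) x) %[ae mu].
Proof.
elim: n => [|n IH].
  rewrite big_ord0 -class_Lspace0; apply: ae_eq_trans (class_LspaceE 0) _.
  by apply: filterE => x _ /=; rewrite big_ord0.
rewrite big_ord_recr/=; apply: filterS2 (repr_LspaceD (\sum_(k < n) F k) (F n)) IH => x Dx IHx _.
by rewrite big_ord_recr/= -IHx// Dx.
Qed.

Lemma norm_Lspace_average (F : nat -> LspaceType1 mu) n :
  `|n%:R^-1 *: \sum_(k < n) F k| =
  \int[mu]_x `|average (fun k => (F k : X -> R)) n x|.
Proof.
rewrite norm_Lspace1_Rintegral; apply: eq_Rintegral_ae.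
- apply: measurableT_comp => //; exact: repr_Lspace_measurable.
- apply: measurableT_comp => //.
  by apply: (@L1_measurable _ _ _ mu); apply: L1_average => k; exact: L1_repr.
- apply: filterS2 (repr_LspaceZ n%:R^-1 (\sum_(k < n) F k)) (repr_Lspace_sum F n) => x Zx Sx _.
  by rewrite Zx//= Sx.
Qed.

End transfer_to_Lspace1.

Theorem theorem1p1 (d : measure_display) (X : measurableType d) (R : realType)
    (mu : {measure set X -> \bar R}) :
  weak_banach_saks (LspaceType1 mu).
Proof.
move=> u l /weakly_cvg_null f0.
have [n_ nS nC] := weakly_null_banach_saks (fun n => L1_repr (u n - l)) f0.
exists n_; first by apply: homo_ltn nS => ? ? ?; exact: ltn_trans.
(* at [j = 0] the empty mean minus [l] is not the empty mean of the differences *)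
apply: cvg_trans nC; apply: near_eq_cvg; exists 1%N => // j /= j0.
rewrite -[LHS](norm_Lspace_average (fun k => u (n_ k) - l) j) sumrB sumr_const card_ord.
rewrite scalerBr -[l *+ j]scaler_nat scalerA mulVf ?scale1r//.
by rewrite pnatr_eq0 -lt0n.
Qed.
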